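(* For every integer $n\ge4$ and every primitive $n$-th root of unity $\zeta_n$, $$[\mathbb{Q}(\zeta_n):\mathbb{Q}]\ge \frac{n^{1/40}(\log n)^{-1/2}}{6}.$$ *)

(* Defs.v *)
From HB Require Import structures.
From mathcomp Require Export all_boot all_order all_algebra all_field.
From mathcomp Require Export reals exp.

Set Implicit Arguments.
Unset Strict Implicit.
Unset Printing Implicit Defensive.

Export Order.TTheory GRing.Theory Num.Theory.

(* A primitive n-th root of unity lives in an arbitrary finite extension L of
   the rationals. Since a primitive root of unity is algebraic, this covers the
   complex ones: for z in algC, num_field_exists supplies such an L together
   with an embedding of L into algC having z in its image. The subfield Q(z) of
   L is <<1; z>>%AS, with 1%AS the copy of the rationals inside L. *)

(* Main.v *)
Require Import Defs.
From mathcomp Require Import sequences zify lra.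

(** The degree of [Q(zeta)] over [Q] is [totient n] ([dim_prim_root]), and
    [totient n] is at least [Num.sqrt (n / 2)] ([leq_double_totient_sq]). The
    bound to be proved is far weaker: [ln n] is at least 1 once [n] is at least
    4 ([ln_ge1]), so the logarithmic factor is at most 1, and the exponent 1/40
    may be raised to 1/2. What is left is that [Num.sqrt n / 6] is at most
    [totient n].

    The totient bound is multiplicative. For a prime power [q = p ^ e], [q] is
    at most [totient q ^ 2], unless [q = 2], where a factor 2 is lost; only one
    prime factor of [n] can be 2, so the total loss is at most 2.

    The degree is already known for complex roots of unity, whose minimal
    polynomials are cyclotomic. It is transferred to an arbitrary extension
    [L]: the minimal polynomial of [zeta] has rational coefficients, so it has
    a complex root [z], and [z] and [zeta] are roots of the same rational
    polynomials. *)

Local Open Scope ring_scope.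

(** For odd [p], [p <= p.-1 ^ 2] because [p] is at least 3; for [p = 2] that
    fails and the extra factor 2 compensates. The remaining power [p ^ e.-1]
    only grows when squared. *)
Lemma leq_pfactor_totient_sq (p e : nat) : prime p -> (0 < e)%N ->
  (p ^ e <= (if p == 2 then 2 else 1) * (p.-1 * p ^ e.-1) ^ 2)%N.
Proof.
case: e => // e p_pr _ /=; have pe_gt0 : (0 < p ^ e)%N by rewrite expn_gt0 prime_gt0.
have pe_sq : (p ^ e <= (p ^ e) ^ 2)%N by rewrite -mulnn leq_pmull.
rewrite expnMn expnS mulnA; apply: leq_mul => //.
case: eqP => [-> // | /eqP p_neq2]; rewrite mul1n.
have := prime_gt1 p_pr; case: p p_neq2 {p_pr pe_gt0 pe_sq} => [|[|[|p]]] //= _ _.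
by rewrite -mulnn; nia.
Qed.

(** Equality holds for [n = 2], so the constant 2 is sharp. *)
Lemma leq_double_totient_sq (n : nat) : (0 < n)%N -> (n <= 2 * totient n ^ 2)%N.
Proof.
move=> n_gt0; rewrite totientE // {1}[n]prod_prime_decomp // prime_decompE big_map /=.
set s := primes n; set c := fun p => (if p == 2 then 2 else 1)%N.
have s_uniq : uniq s by exact: primes_uniq.
rewrite -[leqRHS]mulnC -mulnn -big_split /=.
have cs : (\prod_(p <- s) c p <= 2)%N.
  have [s2|s2] := boolP (2%N \in s).
    rewrite (big_rem 2%N) //= {1}/c eqxx big_seq big1 ?muln1 // => p.
    by rewrite mem_rem_uniq // !inE => /andP[/negbTE + _]; rewrite /c => ->.
  rewrite big_seq big1 // => p ps; rewrite /c; case: eqP => // p2.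
  by rewrite -p2 ps in s2.
apply: (@leq_trans (\prod_(p <- s) c p * \prod_(p <- s) (p.-1 * p ^ (logn p n).-1) ^ 2)%N).
  rewrite -big_split /= !big_seq; elim/big_ind2: _ => // [*|p ps]; first exact: leq_mul.
  move: ps; rewrite mem_primes => /and3P[p_pr _ pn].
  by apply: leq_pfactor_totient_sq; rewrite // logn_gt0 mem_primes p_pr n_gt0.
by rewrite mulnC leq_mul.
Qed.

(** Being a primitive [n]-th root of unity depends only on which of the rational
    polynomials ['X^m - 1] vanish. Hence a complex root [z] of the rational
    minimal polynomial [p] of [zeta] is again a primitive [n]-th root of unity;
    its minimal polynomial [r] divides [p], so equals it up to a constant by
    irreducibility, and is the [n]-th cyclotomic polynomial. *)
Lemma dim_prim_root (n : nat) (L : fieldExtType rat) (zeta : L) :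
  n.-primitive_root zeta ->
  \dim_(1%AS : {subfield L}) <<1; zeta>>%AS = totient n.
Proof.
move=> zeta_prim; rewrite -adjoin_degreeE.
apply: succn_inj; rewrite -size_minPoly.
have /polyOver1P[p def_p] := minPolyOver 1%AS zeta.
have over1 (q : {poly rat}) : map_poly (in_alg L) q \is a polyOver 1%AS.
  by apply/polyOver1P; exists q.
have root_zeta (q : {poly rat}) : root (map_poly (in_alg L) q) zeta = (p %| q).
  rewrite -(dvdp_map (in_alg L)) -def_p; apply/idP/idP => [|pq].
    by apply: minPoly_dvdp.
  by rewrite -dvdp_XsubCl (dvdp_trans _ pq) // dvdp_XsubCl root_minPoly.
have sz_p : size p = size (minPoly 1%AS zeta) by rewrite def_p size_map_poly.
have [z z_root] : exists z : algC, root (map_poly ratr p) z.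
  by apply/closed_rootP; rewrite size_map_poly sz_p size_minPoly.
have [r [def_r _] root_z] := minCpolyP z.
have rp : r %| p by rewrite -root_z.
have r_neq1 : ~~ (r %= 1).
  by rewrite -size_poly_eq1 -(size_map_poly (ratr : {rmorphism rat -> algC}) r) -def_r gtn_eqF ?size_minCpoly.
have r_eqp : r %= p.
  have := @minPoly_irr _ _ 1%AS zeta _ (over1 r); rewrite def_p dvdp_map => /(_ rp).
  by rewrite -(rmorph1 (map_poly (in_alg L))) !eqp_map (negbTE r_neq1) orbF.
have z_prim : n.-primitive_root z.
  have unity_eq m : m.-unity_root z = m.-unity_root zeta.
    have mapE (F : unitRingType) (f : {rmorphism rat -> F}) :
        'X^m - 1 = map_poly f ('X^m - 1).
      by rewrite rmorphB rmorph1 /= map_polyXn.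
    rewrite /root_of_unity (mapE _ (in_alg L)) (mapE _ ratr) root_z root_zeta.
    exact: eqp_dvdl.
  move: zeta_prim; rewrite /primitive_root_of_unity => /andP[-> /=].
  by under eq_forallb do rewrite -unity_eq.
by rewrite -sz_p -(eqp_size r_eqp) -(size_map_poly (ratr : {rmorphism rat -> algC}) r) -def_r
  (minCpoly_cyclotomic z_prim) size_cyclotomic.
Qed.

(** From [1 / 2 <= expR (- (1 / 2))] follows [expR (1 / 2) <= 2], and squaring
    gives [expR 1 <= 4]. *)
Lemma ln_ge1 (R : realType) (x : R) : 4 <= x -> 1 <= ln x.
Proof.
move=> x_ge4; have x_gt0 : 0 < x by lra.
rewrite -ler_expR lnK ?posrE //; apply: le_trans x_ge4.
have := expR_ge1Dx (- (1 / 2) : R); rewrite expRN => half_le.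
have e_gt0 := expR_gt0 (1 / 2 : R).
have e_le2 : expR (1 / 2 : R) <= 2.
  have : expR (1 / 2 : R) * (expR (1 / 2))^-1 = 1 by rewrite mulfV ?gt_eqF.
  nra.
have -> : (1 : R) = 1 / 2 + 1 / 2 by lra.
by rewrite expRD; nra.
Qed.

Theorem corollary1 (R : realType) (n : nat) (hn : (4 <= n)%N)
  (L : fieldExtType rat) (zeta : L) (hzeta : n.-primitive_root zeta) :
  (n%:R : R) `^ (1 / 40%:R) * (ln (n%:R : R)) `^ (- (1 / 2%:R)) / 6%:R
    <= (\dim_(1%AS : {subfield L}) <<1; zeta>>%AS)%:R.
Proof.
rewrite (dim_prim_root _ _ _ hzeta).
have n_ge4 : 4 <= n%:R :> R by rewrite ler_nat.
have ln_factor : ln (n%:R : R) `^ (- (1 / 2)) <= 1.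
  by rewrite -[leRHS](powRr0 (ln (n%:R : R))) ler_powR ?ln_ge1 //; lra.
have pow_le : (n%:R : R) `^ (1 / 40) <= Num.sqrt n%:R.
  by rewrite -powR12_sqrt ?ler_powR //; lra.
have sqrt_le : Num.sqrt (n%:R : R) <= 2 * (totient n)%:R.
  rewrite -[leRHS]ger0_norm ?mulr_ge0 // -sqrtr_sqr ler_wsqrtr //.
  rewrite -natrM -natrX ler_nat.
  have := leq_double_totient_sq _ (leq_trans (isT : (0 < 4)%N) hn).
  rewrite expnMn; lia.
have := powR_ge0 (n%:R : R) (1 / 40).
have := powR_ge0 (ln (n%:R : R)) (- (1 / 2)).
nra.
Qed.
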